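(* Let $G_1, G_2$ be finite non-abelian groups, let $H_i$ be a subgroup of $G_i$ with $H_i \neq Z(H_i,G_i)$ for $i=1,2$, and let $g \in K(H_1,G_1)$. Let $(\phi,\psi)$ be a relative isoclinism between the pairs $(H_1,G_1)$ and $(H_2,G_2)$. If $|Z(H_1,G_1)| = |Z(H_2,G_2)|$, then the graph $\Gamma_{H_1,G_1}^{g}$ is isomorphic to the graph $\Gamma_{H_2,G_2}^{\psi(g)}$.
   Context: For $x,y$ in a group, $[x,y] = x^{-1}y^{-1}xy$. For a subgroup $H$ of a group $G$: $Z(H,G) = \{x \in H : xy = yx \text{ for all } y \in G\}$, $K(H,G) = \{[x,y] : x \in H,\ y \in G\}$, and $[H,G] = \langle K(H,G)\rangle$. For $g \in G$, the relative $g$-noncommuting graph $\Gamma_{H,G}^g$ is the simple undirected graph with vertex set $G$ in which two distinct vertices $x,y$ are adjacent if and only if ($x \in H$ or $y \in H$) and $[x,y] \neq g$ and $[x,y] \neq g^{-1}$. A relative isoclinism between $(H_1,G_1)$ and $(H_2,G_2)$ (where $H_i \leq G_i$) is a pair $(\phi,\psi)$ of group isomorphisms $\phi : G_1/Z(H_1,G_1) \to G_2/Z(H_2,G_2)$ and $\psi : [H_1,G_1] \to [H_2,G_2]$ such that $\phi\left(H_1/Z(H_1,G_1)\right) = H_2/Z(H_2,G_2)$ and $\psi \circ a_{(H_1,G_1)} = a_{(H_2,G_2)} \circ (\phi\times\phi)$, where $a_{(H_i,G_i)} : \frac{H_i}{Z(H_i,G_i)} \times \frac{G_i}{Z(H_i,G_i)}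 \to [H_i,G_i]$ is given by $a_{(H_i,G_i)}\left((h_iZ(H_i,G_i), g_iZ(H_i,G_i))\right) = [h_i,g_i]$ and $\phi\times\phi$ denotes the map $\frac{H_1}{Z(H_1,G_1)} \times \frac{G_1}{Z(H_1,G_1)} \to \frac{H_2}{Z(H_2,G_2)} \times \frac{G_2}{Z(H_2,G_2)}$ applying $\phi$ in each coordinate. Equivalently, for all $h_1 \in H_1$ and $g_1 \in G_1$, $\psi([h_1,g_1]) = [h_2,g_2]$ whenever $h_2 \in \phi(h_1Z(H_1,G_1))$ and $g_2 \in \phi(g_1Z(H_1,G_1))$. *)

(* Defs.v *)
From HB Require Import structures.
From mathcomp Require Import all_boot all_fingroup.

Set Implicit Arguments.
Unset Strict Implicit.
Unset Printing Implicit Defensive.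

Local Open Scope group_scope.

(* With the library's conventions, [~ x, y] = x^-1 * y^-1 * x * y, and for   *)
(* H \subset G: 'C_H(G) is Z(H, G), commg_set H G is K(H, G), and            *)
(* [~: H, G] = <<commg_set H G>>.                                            *)

Record sgraph := SGraph {
  vertex : finType;
  adj : rel vertex;
  adj_sym : symmetric adj;
  adj_irr : irreflexive adj
}.

Definition graph_iso (X Y : sgraph) (f : vertex X -> vertex Y) : Prop :=
  bijective f /\ forall x y, adj (f x) (f y) = adj x y.

Definition isomorphic (X Y : sgraph) : Prop :=
  exists f : vertex X -> vertex Y, graph_iso f.

Section RelativeNoncommutingGraph.

Variables (gT : finGroupType) (H G : {group gT}) (g : gT).

Definition rnc_adj : rel (subg_of G) := fun u v =>
  let x := sgval u in let y := sgval v in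
  [&& u != v, (x \in H) || (y \in H), [~ x, y] != g & [~ x, y] != g^-1].

Lemma rnc_adj_sym : symmetric rnc_adj.
Proof.
move=> u v; rewrite /rnc_adj /= eq_sym orbC; congr [&& _, _ & _].
by rewrite -(invg_comm (sgval v)) eq_invg_sym eq_sym (inj_eq invg_inj) eq_sym andbC.
Qed.

Lemma rnc_adj_irr : irreflexive rnc_adj.
Proof. by move=> u; rewrite /rnc_adj eqxx. Qed.

Definition rnc_graph : sgraph := SGraph rnc_adj_sym rnc_adj_irr.

End RelativeNoncommutingGraph.

Section CommutatorMap.

Variables (gT : finGroupType) (H G : {group gT}).

(* The map a_(H,G), computed on arbitrary representatives of the cosets;      *)
(* comm_map_coset shows that the choice of representatives is irrelevant.     *)
Definition comm_map (u v : coset_of 'C_H(G)) : gT := [~ repr u, repr v].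

Lemma comm_map_coset (h k : gT) : H \subset G -> h \in H -> k \in G ->
  comm_map (coset 'C_H(G) h) (coset 'C_H(G) k) = [~ h, k].
Proof.
move=> sHG Hh Gk; have Gh := subsetP sHG h Hh.
have nZG : G \subset 'N('C_H(G)).
  by rewrite cents_norm // centsC subsetIr.
have reprE x : x \in G ->
    exists2 z, z \in 'C(G) & z * x \in G /\ repr (coset 'C_H(G) x) = z * x.
  move=> Gx; have Nx := subsetP nZG x Gx.
  have: repr (coset 'C_H(G) x) \in 'C_H(G) :* x.
    by rewrite -val_coset // mem_repr_coset.
  case/rcosetP=> z /setIP[Hz Cz] ->; exists z => //.
  by rewrite groupM // (subsetP sHG).
have commL (z x w : gT) : commute z w -> [~ z * x, w] = [~ x, w].
  move=> czw; rewrite !commgEl invMg conjMg.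
  have -> : z ^ w = z by apply/conjg_fixP/commgP.
  by rewrite mulgA mulgKV.
have [z Cz [_ zh]] := reprE h Gh; have [t Ct [Gtk tk]] := reprE k Gk.
rewrite /comm_map zh tk commL; last exact: (centP Cz).
by rewrite -invgR commL ?invgR //; apply: (centP Ct).
Qed.

End CommutatorMap.

Definition relative_isoclinism (gT1 gT2 : finGroupType)
    (H1 G1 : {group gT1}) (H2 G2 : {group gT2})
    (phi : {morphism (G1 / 'C_H1(G1)) >-> coset_of 'C_H2(G2)})
    (psi : {morphism [~: H1, G1] >-> gT2}) : Prop :=
  [/\ isom (G1 / 'C_H1(G1)) (G2 / 'C_H2(G2)) phi,
      isom [~: H1, G1] [~: H2, G2] psi,
      phi @* (H1 / 'C_H1(G1)) = H2 / 'C_H2(G2)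
    & {in H1 / 'C_H1(G1) & G1 / 'C_H1(G1), forall u v,
         psi (comm_map u v) = comm_map (phi u) (phi v)}].

(* Main.v *)
Require Import Defs.
From HB Require Import structures.
From mathcomp Require Import all_boot all_fingroup.

Local Open Scope group_scope.

(** Write Zi for 'C_Hi(Gi). Whether x \in Hi, and the commutator [~ x, y] of an
    element of Hi with an element of Gi, depend only on cosets modulo the
    central subgroup Zi. Hence any bijection f from G1 to G2 that lifts phi,
    i.e. such that f x lies in the coset phi (x Z1), preserves membership in
    the subgroups and satisfies psi [~ x, y] = [~ f x, f y] when x \in H1. As
    psi is an injective morphism, the conditions [~ x, y] != g and
    [~ x, y] != g^-1 are carried to the same conditions for psi g, so f is a
    graph isomorphism.

    Such an f, which is in general no morphism, exists because phi matches the
    cosets of Z1 with those of Z2 and all these cosets have the same size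
    #|Z1| = #|Z2|: pick a bijection on each coset
    ([bijection_over], [card_coset_fibre]). *)

(** Finite sets over the same base with equinumerous fibres are isomorphic over
    that base: match the i-th element of each fibre with the i-th element of the
    fibre over the same point. *)
Lemma bijection_over (S T : finType) (C : eqType) (p : S -> C) (q : T -> C) :
    (forall c, #|[pred s | p s == c]| = #|[pred t | q t == c]|) ->
  exists2 f : S -> T, bijective f & forall s, q (f s) = p s.
Proof.
move=> eq_fibres.
(* A point d s over p s serves as default value for nth. *)
have /fin_all_exists[d _] : forall s, exists t, q t = p s.
  move=> s; have: 0 < #|[pred t | q t == p s]|.
    by rewrite -eq_fibres; apply/card_gt0P; exists s; rewrite inE.
  by case/card_gt0P=> t /[!inE] /eqP; exists t.
pose eS c := enum [pred s | p s == c]; pose eT c := enum [pred t | q t == c].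
pose f s := nth (d s) (eT (p s)) (index s (eS (p s))).
have ltf s : index s (eS (p s)) < size (eT (p s)).
  by rewrite -cardE -eq_fibres cardE index_mem mem_enum inE.
have qf s : q (f s) = p s.
  by have := mem_nth (d s) (ltf s); rewrite mem_enum inE => /eqP.
have injf : injective f.
  move=> s1 s2 eqf; have eqp : p s1 = p s2 by rewrite -!qf eqf.
  have s1in : s1 \in eS (p s2) by rewrite mem_enum inE eqp.
  have s2in : s2 \in eS (p s2) by rewrite mem_enum inE.
  apply: (index_inj s1 s1in s2in).
  have lt1 := ltf s1; rewrite eqp in lt1.
  move: eqf; rewrite /f eqp (set_nth_default (d s2)) // => /eqP.
  by rewrite nth_uniq ?enum_uniq // => /eqP.
exists f => //; apply: (inj_card_bij injf).
(* f is onto: by counting, its injective restriction to the fibre of p over q t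
   fills the fibre of q that contains t. *)
rewrite -(card_codom injf) subset_leq_card //; apply/subsetP=> t _.
have sfib : [set f s | s in [pred s | p s == q t]] \subset
            [set t' | q t' == q t].
  by apply/subsetP=> _ /imsetP[s /[!inE] /eqP ps ->]; rewrite qf ps.
have: t \in [set t' | q t' == q t] by rewrite inE.
have /eqP <- : [set f s | s in [pred s | p s == q t]] == [set t' | q t' == q t].
  by rewrite eqEcard sfib card_imset // cardsE -eq_fibres leqnn.
by case/imsetP=> s _ ->; apply: codom_f.
Qed.

Section CentralCosets.

Variables (gT : finGroupType) (H G : {group gT}).

Let Z := 'C_H(G).

Lemma sub_norm_relcenter : G \subset 'N(Z).
Proof. by rewrite cents_norm // centsC subsetIr. Qed.

(** Taking the vertices in the type subg_of G does not change the fibre: since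
    Z is contained in G, it is the whole coset Z x. *)
Lemma card_coset_fibre (x : gT) : H \subset G -> x \in G ->
  #|[pred u : subg_of G | coset Z (sgval u) == coset Z x]| = #|Z|.
Proof.
move=> sHG Gx; rewrite -(card_rcoset Z x) -(card_imset _ (@subg_inj _ G)).
have Nx := subsetP sub_norm_relcenter x Gx.
apply: eq_card => y; apply/imsetP/idP => [[u /[!inE] /eqP eq_ux ->] | Zxy].
  have Nu := subsetP sub_norm_relcenter _ (subgP u).
  by rewrite rcoset_sym; apply/rcoset_kercosetP; rewrite ?eq_ux.
have Gy : y \in G.
  case/rcosetP: Zxy => z /setIP[Hz _] ->.
  by rewrite groupM // (subsetP sHG).
exists (subg G y); last by rewrite subgK.
have Ny := subsetP sub_norm_relcenter y Gy.
by rewrite inE subgK //; apply/eqP/rcoset_kercosetP => //; rewrite rcoset_sym.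
Qed.

(** H contains Z, hence is a union of cosets of Z. *)
Lemma mem_quotient_relcenter (x : gT) : x \in G ->
  (coset Z x \in H / Z) = (x \in H).
Proof.
move=> Gx; have Nx := subsetP sub_norm_relcenter x Gx.
apply/idP/idP => [|Hx]; last exact: mem_quotient.
case/morphimP=> h Nh Hh /eqP; rewrite eq_sym => /eqP /rcoset_kercosetP.
move=> /(_ Nh Nx); rewrite rcoset_sym => /rcosetP[z /setIP[Hz _] ->].
by rewrite groupM.
Qed.

End CentralCosets.

Theorem theorem2p12 (gT1 gT2 : finGroupType)
    (G1 H1 : {group gT1}) (G2 H2 : {group gT2}) (g : gT1)
    (phi : {morphism (G1 / 'C_H1(G1)) >-> coset_of 'C_H2(G2)})
    (psi : {morphism [~: H1, G1] >-> gT2}) :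
  ~~ abelian G1 -> ~~ abelian G2 ->
  H1 \subset G1 -> H2 \subset G2 ->
  H1 :!=: 'C_H1(G1) -> H2 :!=: 'C_H2(G2) ->
  g \in commg_set H1 G1 ->
  relative_isoclinism phi psi ->
  #|'C_H1(G1)| = #|'C_H2(G2)| ->
  isomorphic (rnc_graph H1 G1 g) (rnc_graph H2 G2 (psi g)).
Proof.
move=> _ _ sHG1 sHG2 _ _ Kg [/isomP[injphi imphi] /isomP[injpsi _] phiH eqpsi].
move=> eqZ.
have Gc (u : subg_of G1) : coset 'C_H1(G1) (sgval u) \in G1 / 'C_H1(G1).
  by rewrite mem_quotient ?subgP.
pose p (u : subg_of G1) := phi (coset 'C_H1(G1) (sgval u)).
pose q (v : subg_of G2) := coset 'C_H2(G2) (sgval v).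
have [c | f bijf qf] := @bijection_over _ _ _ p q.
  have [Gc2 | notGc2] := boolP (c \in G2 / 'C_H2(G2)); last first.
    (* p and q both take their values in G2 / 'C_H2(G2). *)
    rewrite !eq_card0 // => u; rewrite inE; apply: contraNF notGc2 => /eqP <-.
      by rewrite mem_quotient ?subgP.
    by rewrite -imphi mem_morphim.
  have /morphimP[y _ Gy /= def_c] := Gc2.
  have /morphimP[_ _ /morphimP[x _ Gx ->] /= def_phi] :
    c \in phi @* (G1 / 'C_H1(G1)) by rewrite imphi.
  transitivity #|'C_H1(G1)|.
    rewrite -(card_coset_fibre _ _ _ _ sHG1 Gx) def_phi; apply: eq_card => u.
    by rewrite !inE (inj_in_eq (injmP injphi)) ?mem_quotient ?subgP.
  by rewrite eqZ def_c (card_coset_fibre _ _ _ _ sHG2).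
exists f; split=> //= u v.
have memH w : (sgval (f w) \in H2) = (sgval w \in H1).
  rewrite -(mem_quotient_relcenter _ H2 G2) ?subgP // -/(q _) qf -phiH.
  rewrite -(mem_quotient_relcenter _ H1 G1) ?subgP //.
  have sHG1q : H1 / 'C_H1(G1) \subset G1 / 'C_H1(G1) by rewrite quotientS.
  by rewrite -{2}(injmK injphi sHG1q) [RHS]inE Gc [RHS]inE.
have psiR w z : sgval w \in H1 ->
    psi [~ sgval w, sgval z] = [~ sgval (f w), sgval (f z)].
  move=> Hw; rewrite -(comm_map_coset sHG1) ?subgP // eqpsi ?mem_quotient ?subgP //.
  by rewrite -/(p w) -/(p z) -!qf comm_map_coset ?memH ?subgP.
have Gg : g \in [~: H1, G1] by apply: mem_gen.
have psi_eq w z : sgval w \in H1 ->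
    ([~ sgval (f w), sgval (f z)] == psi g) = ([~ sgval w, sgval z] == g) /\
    ([~ sgval (f w), sgval (f z)] == (psi g)^-1) = ([~ sgval w, sgval z] == g^-1).
  move=> Hw; have Rwz : [~ sgval w, sgval z] \in [~: H1, G1].
    by rewrite mem_commg ?subgP.
  by rewrite -psiR // -morphV // !(inj_in_eq (injmP injpsi)) ?groupV.
(* Adjacency is symmetric, so the endpoint in H1 may be taken first. *)
wlog Hu : u v / sgval u \in H1.
  move=> IH; have [|nHu] := boolP (sgval u \in H1); first exact: IH.
  have [Hv|nHv] := boolP (sgval v \in H1).
    by rewrite rnc_adj_sym [RHS]rnc_adj_sym; apply: IH.
  by rewrite /rnc_adj !memH (negPf nHu) (negPf nHv) !andbF.
by rewrite /rnc_adj !memH (bij_eq bijf); have [-> ->] := psi_eq u v Hu.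
Qed.
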